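(* Let $N_{22}$ be the free nilpotent group of rank $2$ and nilpotency class $2$. Then its Reidemeister spectrum is $$Spec_R(N_{22}) = 2\mathbb{N} \cup \{\infty\}, \qquad 2\mathbb{N}=\{2k \mid k\in\mathbb{N}\}.$$
   Context: Here $\mathbb{N}$ denotes the positive integers. The free nilpotent group $N_{rc}$ of rank $r$ and class $c$ is $F_r/\gamma_{c+1}(F_r)$, where $F_r$ is the free group of rank $r$ and $\gamma_i$ denotes the $i$-th term of the lower central series ($\gamma_1(G)=G$). Automorphisms are written on the right: $x\varphi$ is the image of $x$ under $\varphi$. For a group $G$ and an automorphism $\varphi$ of $G$, elements $g,f\in G$ are $\varphi$-twisted conjugate if there exists $x\in G$ with $(x\varphi)g = fx$. This is an equivalence relation; the Reidemeister number $R(\varphi)$ is the number of its equivalence classes, with $R(\varphi)=\infty$ if there are infinitely many. The Reidemeister spectrum of $G$ is $Spec_R(G)=\{R(\varphi)\mid \varphi\in Aut(G)\}$. *)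

(* Defs.v *)
From HB Require Import structures.
From mathcomp Require Import all_boot finmap.
From mathcomp Require Import boolp classical_sets functions cardinality.

Set Implicit Arguments.
Unset Strict Implicit.
Unset Printing Implicit Defensive.

Local Open Scope classical_set_scope.
Local Open Scope group_scope.
Local Open Scope quotient_scope.

(* The free group of rank r is realized on the reduced words; the letter      *)
(* (i, false) is the i-th generator and (i, true) is its formal inverse.      *)

Notation letter r := ('I_r * bool)%type.

Definition linv r (a : letter r) : letter r := (a.1, ~~ a.2).

Definition reduced r (w : seq (letter r)) : bool :=
  sorted (fun a b => b != linv a) w.

Definition push r (a : letter r) (w : seq (letter r)) : seq (letter r) :=
  if w is b :: w' then if b == linv a then w' else a :: w else [:: a].

(* reduced form of the concatenation of u and v, when v is reduced            *)
Definition word_mul r (u v : seq (letter r)) := foldr (@push r) v u.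

Definition word_inv r (u : seq (letter r)) := rev (map (@linv r) u).

Section WordTheory.
Variable r : nat.
Implicit Types (a b : letter r) (u v w : seq (letter r)).

Lemma linvK : involutive (@linv r).
Proof. by case=> i b; rewrite /linv /= negbK. Qed.

Lemma linv_eqC a b : (b == linv a) = (a == linv b).
Proof. by apply/eqP/eqP => ->; rewrite linvK. Qed.

Lemma push_reduced a w : reduced w -> reduced (push a w).
Proof.
case: w => [|b w] //= hw; case: ifPn => [_|nb]; first exact: path_sorted hw.
by rewrite /= nb.
Qed.

Lemma word_mul_reduced u v : reduced v -> reduced (word_mul u v).
Proof. by move=> hv; elim: u => //= a u; apply: push_reduced. Qed.

Lemma pushK a w : reduced w -> push (linv a) (push a w) = w.
Proof.
case: w => [|b w] /= hw; first by rewrite linvK eqxx.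
case: ifPn => [/eqP eb|nb] /=; last by rewrite linvK eqxx.
subst b; case: w hw => [|c w] //= /andP[nc _].
by rewrite (negbTE nc).
Qed.

Lemma pushVK a w : reduced w -> push a (push (linv a) w) = w.
Proof. by move=> hw; rewrite -{1}[a]linvK pushK. Qed.

Lemma word_mul_push a v w : reduced w ->
  word_mul (push a v) w = push a (word_mul v w).
Proof.
move=> hw; case: v => [|b v] //=; case: ifP => [/eqP ->|_] //=.
by rewrite pushVK //; apply: word_mul_reduced.
Qed.

Lemma word_mulA u v w : reduced w ->
  word_mul u (word_mul v w) = word_mul (word_mul u v) w.
Proof. by move=> hw; elim: u => //= a u ->; rewrite word_mul_push. Qed.

Lemma word_mul1 u : reduced u -> word_mul u [::] = u.
Proof.
elim: u => //= a u IH hu; rewrite IH; last exact: path_sorted hu.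
by case: u hu {IH} => [|b u] //= /andP[nb _]; rewrite (negbTE nb).
Qed.

Lemma word_mulKV u v : reduced v -> word_mul (word_inv u) (word_mul u v) = v.
Proof.
move=> hv; elim: u => //= a u IH.
rewrite /word_inv map_cons rev_cons -cats1 /word_mul foldr_cat /= pushK //.
exact: word_mul_reduced.
Qed.

Lemma word_inv_reduced u : reduced u -> reduced (word_inv u).
Proof.
rewrite /reduced /word_inv rev_sorted sorted_map.
by apply: sub_sorted => a b /=; rewrite linvK eq_sym.
Qed.

Lemma word_invK : involutive (@word_inv r).
Proof. by move=> u; rewrite /word_inv map_rev revK mapK //; exact: linvK. Qed.

End WordTheory.

Record free_group (r : nat) := FreeGroup {
  word_of :> seq (letter r);
  word_ofP : reduced word_of }.

HB.instance Definition _ r := [isSub for @word_of r].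
HB.instance Definition _ r := [Countable of free_group r by <:].

Section FreeGroup.
Variable r : nat.
Implicit Types x y z : free_group r.

Definition fg_one : free_group r := @FreeGroup r [::] isT.
Definition fg_mul x y : free_group r :=
  FreeGroup (word_mul_reduced x (word_ofP y)).
Definition fg_inv x : free_group r := FreeGroup (word_inv_reduced (word_ofP x)).

Lemma fg_mulA : associative fg_mul.
Proof. by move=> x y z; apply/val_inj/word_mulA/word_ofP. Qed.

Lemma fg_mul1 : left_id fg_one fg_mul.
Proof. by move=> x; apply/val_inj. Qed.

Lemma fg_mulr1 : right_id fg_one fg_mul.
Proof. by move=> x; apply/val_inj/word_mul1/word_ofP. Qed.

Lemma fg_mulV : left_inverse fg_one fg_inv fg_mul.
Proof.
move=> x; apply/val_inj => /=.
by rewrite -{2}[word_of x]word_mul1 ?word_mulKV //; apply: word_ofP.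
Qed.

Lemma fg_mulrV : right_inverse fg_one fg_inv fg_mul.
Proof.
move=> x; rewrite -{1}[x](_ : fg_inv (fg_inv x) = x) ?fg_mulV //.
exact/val_inj/word_invK.
Qed.

End FreeGroup.

HB.instance Definition _ r := isGroup.Build (free_group r)
  (@fg_mulA r) (@fg_mul1 r) (@fg_mulr1 r) (@fg_mulV r) (@fg_mulrV r).

Definition is_subgroup (G : groupType) (H : set G) : Prop :=
  H 1 /\ forall x y, H x -> H y -> H (x / y).

Definition is_normal_subgroup (G : groupType) (H : set G) : Prop :=
  is_subgroup H /\ forall x y, H x -> H (x ^ y).

Definition gen_subgroup (G : groupType) (A : set G) : set G :=
  smallest (@is_subgroup G) A.

Definition commutator_subgroup (G : groupType) (A B : set G) : set G :=
  gen_subgroup [set [~ x, y] | x in A & y in B].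

(* indexed from 1: lcs 1 = G, and the index 0 is a junk value                 *)
Definition lcs (G : groupType) (i : nat) : set G :=
  iter i.-1 (fun H => commutator_subgroup H [set: G]) [set: G].

Section Normal.
Variable G : groupType.

Lemma gen_subgroupP (A : set G) : is_subgroup (gen_subgroup A).
Proof.
split=> [H [[]]|x y hx hy H [sH AH]] //.
by apply: (sH.2); [apply: hx|apply: hy].
Qed.

Lemma commutator_normal (H : set G) :
  is_normal_subgroup H -> is_normal_subgroup (commutator_subgroup H [set: G]).
Proof.
move=> [_ nH]; split; first exact: gen_subgroupP.
move=> x z hx.
have [c1 cF] := gen_subgroupP [set [~ x, y] | x in H & y in setT].
apply: (hx [set x | commutator_subgroup H setT (x ^ z)]); split.
  split=> /= [|u v hu hv]; first by rewrite conj1g.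
  by rewrite conjMg conjVg; apply: cF.
move=> _ [u hu [v _ <-]] /=; rewrite conjRg.
by apply: sub_gen_smallest; exists (u ^ z); [exact: nH|exists (v ^ z)].
Qed.

Lemma lcs_normal i : is_normal_subgroup (@lcs G i).
Proof.
by rewrite /lcs; elim: i.-1 => [|n IH] //; apply: commutator_normal.
Qed.

End Normal.

Record normal_subgroup (G : groupType) := NormalSubgroup {
  nsg_set :> G -> Prop;
  nsgP : is_normal_subgroup nsg_set }.

Definition lcs_nsg (G : groupType) (i : nat) : normal_subgroup G :=
  NormalSubgroup (@lcs_normal G i).

Section Quotient.
Variables (G : groupType) (H : normal_subgroup G).

Definition coset_rel : rel G := fun x y => `[< H (x^-1 * y) >].

Lemma coset_relP x y : reflect (H (x^-1 * y)) (coset_rel x y).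
Proof. exact: asboolP. Qed.

Lemma nsgV x : H x -> H x^-1.
Proof. by have [[h1 hF] _] := nsgP H; move=> hx; rewrite -div1g; apply: hF. Qed.

Lemma nsgM x y : H x -> H y -> H (x * y).
Proof.
have [[_ hF] _] := nsgP H; move=> hx /nsgV hy.
by rewrite -[y]invgK; apply: hF.
Qed.

Lemma nsgJ x y : H x -> H (x ^ y).
Proof. by have [_ hJ] := nsgP H; apply: hJ. Qed.

Lemma coset_rel_refl : reflexive coset_rel.
Proof. by move=> x; apply/coset_relP; rewrite mulVg; case: (nsgP H) => -[]. Qed.

Lemma coset_rel_sym : symmetric coset_rel.
Proof.
suff S x y : coset_rel x y -> coset_rel y x.
  by move=> x y; apply/idP/idP; apply: S.
by move=> /coset_relP/nsgV; rewrite invgM invgK => h; apply/coset_relP.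
Qed.

Lemma coset_rel_trans : transitive coset_rel.
Proof.
move=> y x z /coset_relP hxy /coset_relP hyz; apply/coset_relP.
by have := nsgM hxy hyz; rewrite mulgA mulgK.
Qed.

Canonical coset_equiv :=
  EquivRel coset_rel coset_rel_refl coset_rel_sym coset_rel_trans.

Definition quotient_group := {eq_quot coset_equiv}.
HB.instance Definition _ := EqQuotient.on quotient_group.
HB.instance Definition _ := Choice.on quotient_group.

Local Notation proj := (\pi_quotient_group).

Definition quo_one : quotient_group := proj 1.
Definition quo_mul (x y : quotient_group) : quotient_group :=
  proj (repr x * repr y).
Definition quo_inv (x : quotient_group) : quotient_group := proj ((repr x)^-1).

Lemma quo_eqP (x y : G) : reflect (proj x = proj y) (coset_rel x y).
Proof. exact: eqmodP. Qed.

Lemma pi_quo_mul (x y : G) : quo_mul (proj x) (proj y) = proj (x * y).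
Proof.
have /quo_eqP/coset_relP hx := reprK (proj x).
have /quo_eqP/coset_relP hy := reprK (proj y).
apply/quo_eqP/coset_relP; rewrite invgM.
have := nsgM (nsgJ (repr (proj y)) hx) hy.
by rewrite /conjg !mulgA mulgK.
Qed.

Lemma pi_quo_inv (x : G) : quo_inv (proj x) = proj (x^-1).
Proof.
have /quo_eqP/coset_relP hx := reprK (proj x).
apply/quo_eqP/coset_relP; rewrite invgK.
have := nsgJ x^-1 (nsgV hx).
by rewrite /conjg invgM !invgK !mulgA mulgV mul1g.
Qed.

Lemma quoP (q : quotient_group) : exists x : G, q = proj x.
Proof. by exists (repr q); rewrite reprK. Qed.

Lemma quo_mulA : associative quo_mul.
Proof.
move=> p q s; have [x ->] := quoP p; have [y ->] := quoP q.
by have [z ->] := quoP s; rewrite !pi_quo_mul mulgA.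
Qed.

Lemma quo_mul1 : left_id quo_one quo_mul.
Proof. by move=> q; have [x ->] := quoP q; rewrite pi_quo_mul mul1g. Qed.

Lemma quo_mulr1 : right_id quo_one quo_mul.
Proof. by move=> q; have [x ->] := quoP q; rewrite pi_quo_mul mulg1. Qed.

Lemma quo_mulV : left_inverse quo_one quo_inv quo_mul.
Proof.
by move=> q; have [x ->] := quoP q; rewrite pi_quo_inv pi_quo_mul mulVg.
Qed.

Lemma quo_mulrV : right_inverse quo_one quo_inv quo_mul.
Proof.
by move=> q; have [x ->] := quoP q; rewrite pi_quo_inv pi_quo_mul mulgV.
Qed.

HB.instance Definition _ := isGroup.Build quotient_group
  quo_mulA quo_mul1 quo_mulr1 quo_mulV quo_mulrV.

End Quotient.

Definition free_nilpotent (r c : nat) : groupType :=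
  quotient_group (lcs_nsg (free_group r) c.+1).

Section Reidemeister.
Variable G : groupType.
Implicit Type phi : UMagmaMorphism.type G G.

Definition twisted_conj phi (g f : G) : Prop := exists x, phi x * g = f * x.

Lemma twisted_conj_refl phi g : twisted_conj phi g g.
Proof. by exists 1; rewrite gmulf1 mul1g mulg1. Qed.

Lemma twisted_conj_sym phi g f : twisted_conj phi g f -> twisted_conj phi f g.
Proof.
by case=> x e; exists x^-1; rewrite gmulfV -[f](mulgK x) -e mulgA mulKg.
Qed.

Lemma twisted_conj_trans phi g f h :
  twisted_conj phi g f -> twisted_conj phi f h -> twisted_conj phi g h.
Proof.
by case=> x e [y e']; exists (y * x); rewrite gmulfM -mulgA e mulgA e' mulgA.
Qed.

Definition twisted_classes phi : set (set G) :=
  [set [set f | twisted_conj phi g f] | g in [set: G]].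

(* None stands for infinity                                                   *)
Definition Reidemeister_number phi : option nat :=
  if `[< finite_set (twisted_classes phi) >]
  then Some #|` fset_set (twisted_classes phi)|%fset else None.

(* a bijective endomorphism is an automorphism                                *)
Definition Reidemeister_spectrum : set (option nat) :=
  [set Reidemeister_number phi
     | phi in [set phi : UMagmaMorphism.type G G | bijective phi]].

End Reidemeister.

(* Main.v *)
Require Import Defs.
From HB Require Import structures.
From mathcomp Require Import all_boot finmap.
From mathcomp Require Import boolp classical_sets functions cardinality.
From mathcomp Require Import ssralg ssrint intdiv zify ring.

Set Implicit Arguments.
Unset Strict Implicit.
Unset Printing Implicit Defensive.

Local Open Scope classical_set_scope.
Local Open Scope card_scope.
Local Open Scope group_scope.

(** The free nilpotent group of rank and class two is the integral Heisenberg
group, so an automorphism [psi] is described by the matrix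
[M = (p r; q s)] of determinant [d = 1] or [d = -1] that it induces on the
abelianization [Z^2], while on the centre [Z] it acts as multiplication by [d]
([heis_endoE], [heis_det]).

- If [M] has eigenvalue [1], then so does its transpose: some nonzero linear
  form on [Z^2] is invariant under [M], hence constant on twisted classes, and
  there are infinitely many of them ([Reidemeister_heis_eigen1]).
- Otherwise an element fixed modulo the centre is central, so two elements
  that differ by a central [w] are twisted conjugate only if [w] has the form
  [psi(x) / x] with [x] central, that is, lies in [(1 - d) Z].  If [d = 1] the
  central elements are pairwise inequivalent, and there are infinitely many
  classes ([Reidemeister_heis_det1]).
- If [d = -1], multiplication by the generator [z] of the centre is a
  fixed-point free involution of the set of twisted classes; when finite, this
  set therefore has even cardinality ([Reidemeister_heis_detN1]).

Conversely, an automorphism with [M = (k 1; 1 0)] has exactly [2k] classes,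
represented by the elements [(m, 0, n)] with [m < k] and [n < 2]
([Reidemeister_companion_endo]), and the identity has infinitely many.

The isomorphism with the Heisenberg group follows from two universal
properties: [free_lift] maps out of the free group, and [heis_lift] maps the
Heisenberg group to any group, given two elements that commute with their
commutator. *)

(** * Groups and morphisms *)

Section Morphism.
Variables (G H : groupType) (f : G -> H).
Hypothesis fM : {morph f : x y / x * y}.

Lemma morph_mul1 : f 1 = 1.
Proof. by apply: (@mulgI _ (f 1)); rewrite -fM !mulg1. Qed.

Definition morphism_of : UMagmaMorphism.type G H :=
  HB.pack f (isUMagmaMorphism.Build G H f (morph_mul1, fM)).

End Morphism.

(** * Finite sets with a fixed-point free involution *)

(** All orbits of such an involution have two elements. *)
Lemma even_fixfree_involution (T : finType) (f : T -> T) :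
  involutive f -> (forall x, f x != x) -> ~~ odd #|T|.
Proof.
move=> fK fx; rewrite -(@fcard_order_set _ f (inv_inj fK) 2 T) ?muln2 ?odd_double //.
apply/fintype.subsetP => x _; rewrite inE; apply/eqP.
apply: (@order_cycle _ f [:: x; f x]) => /=; first by rewrite fK !eqxx.
- by rewrite inE eq_sym fx.
- by rewrite inE eqxx.
Qed.

Lemma even_set_fixfree_involution (T : choiceType) (A : set T) (f : T -> T) :
    finite_set A -> (forall x, A x -> [/\ A (f x), f (f x) = x & f x <> x]) ->
  ~~ odd #|` fset_set A|.
Proof.
move=> finA Af; set F := fset_set A.
have FA x : x \in F -> A x by rewrite in_fset_set // inE.
have fF (x : F) : f (val x) \in F.
  by rewrite in_fset_set // inE; case: (Af _ (FA _ (valP x))).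
rewrite cardfE; apply: (@even_fixfree_involution _ (fun x => [` fF x]%fset)).
  by move=> x; apply: val_inj; case: (Af _ (FA _ (valP x))).
move=> x; apply/eqP => /(congr1 val) /=.
by case: (Af _ (FA _ (valP x))).
Qed.

(** * Counting twisted conjugacy classes *)

Section Classes.
Variables (G : groupType) (phi : UMagmaMorphism.type G G).

Definition twisted_class (g : G) : set G := [set f | twisted_conj phi g f].

Lemma twisted_classE g g' :
  twisted_class g = twisted_class g' <-> twisted_conj phi g g'.
Proof.
split=> [e|h].
  by have : twisted_class g' g' := twisted_conj_refl phi g'; rewrite -e.
apply/seteqP; split=> f /=; apply: twisted_conj_trans => //.
exact: twisted_conj_sym.
Qed.

Lemma Reidemeister_number_representatives (T : finType) (rep : T -> G) :
    (forall s t, twisted_conj phi (rep s) (rep t) -> s = t) ->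
    (forall f, exists t, twisted_conj phi (rep t) f) ->
  Reidemeister_number phi = Some #|T|.
Proof.
move=> rep_inj rep_surj.
have e : twisted_classes phi = (twisted_class \o rep) @` [set: T].
  apply/seteqP; split=> _ [g _ <-]; last by exists (rep g).
  have [t /twisted_classE ht] := rep_surj g.
  by exists t.
have c : twisted_classes phi #= `I_#|T|.
  rewrite e (card_eqr card_II); apply: (@card_eq_trans _ T _ _ [set: T]).
    by apply: inj_card_eq => s t _ _ /twisted_classE/rep_inj.
  have <- : enum_rank @` [set: T] = [set: 'I_#|T|].
    by apply/seteqP; split=> // i _; exists (enum_val i); rewrite ?enum_valK.
  by rewrite card_eq_sym; apply: inj_card_eq => s t _ _; apply: enum_rank_inj.
rewrite /Reidemeister_number (card_fset_set c); case: asboolP => // -[].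
by exists #|T|.
Qed.

Lemma Reidemeister_number_infinite (F : nat -> G) :
  (forall m n, twisted_conj phi (F m) (F n) -> m = n) ->
  Reidemeister_number phi = None.
Proof.
move=> F_inj; rewrite /Reidemeister_number; case: asboolP => // fin; exfalso.
apply: infinite_nat.
have sub : (twisted_class \o F) @` [set: nat] `<=` twisted_classes phi.
  by move=> _ [n _ <-]; exists (F n).
rewrite -(@eq_finite_set _ _ ((twisted_class \o F) @` [set: nat])).
  exact: sub_finite_set sub fin.
by apply: inj_card_eq => m n _ _ /twisted_classE/F_inj.
Qed.

(** Since [z] is central, [g |-> z * g] maps twisted classes to twisted classes.
It squares to the identity on them, because [z] conjugates [z * (z * g)] to
[g] when [phi z = z^-1]. *)
Lemma Reidemeister_number_even (z : G) :
    (forall g, z * g = g * z) -> phi z = z^-1 ->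
    (forall g, ~ twisted_conj phi (z * g) g) ->
    Reidemeister_number phi <> None ->
  exists2 k, (0 < k)%N & Reidemeister_number phi = Some (2 * k)%N.
Proof.
move=> zC phiz nofix; rewrite /Reidemeister_number; case: asboolP => // fin _.
pose tau (C : set G) : set G := [set f | C (z^-1 * f)].
have tauE g : tau (twisted_class g) = twisted_class (z * g).
  apply/seteqP; split=> f [x hx]; exists x.
    by rewrite mulgA -zC -mulgA hx -!mulgA mulVKg.
  by rewrite -mulgA -hx [phi x * (_ * _)]mulgA -(zC (phi x)) -mulgA mulKg.
have even : ~~ odd #|` fset_set (twisted_classes phi)|.
  apply: (even_set_fixfree_involution (f := tau)) => // _ [g _ <-].
  rewrite -/(twisted_class g) !tauE; split; first by exists (z * g).
    apply/twisted_classE; exists z.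
    by rewrite phiz mulKg zC.
  by move=> /twisted_classE; apply: nofix.
exists #|` fset_set (twisted_classes phi)|./2; last first.
  by rewrite mul2n even_halfK.
rewrite half_gt0 ltn_neqAle; apply/andP; split.
  by apply/eqP => e; move: even; rewrite -e.
rewrite lt0n cardfs_eq0; apply/eqP => /(fset_set_set0 fin).
have : twisted_classes phi (twisted_class 1) by exists 1.
by move=> h e; rewrite e in h.
Qed.

End Classes.

(** * Invariance of the spectrum under isomorphism *)

(** The image under [h] of a twisted class of [phi] is one of [psi]. *)
Lemma Reidemeister_number_conj (G H : groupType)
    (phi : UMagmaMorphism.type G G) (psi : UMagmaMorphism.type H H)
    (h : UMagmaMorphism.type G H) : bijective h ->
    (forall x, psi (h x) = h (phi x)) ->
  Reidemeister_number psi = Reidemeister_number phi.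
Proof.
move=> [h' hK h'K] comm.
have cls g : twisted_class psi (h g) = h @` twisted_class phi g.
  apply/seteqP; split=> [f [x e]|_ [f [x e] <-]]; last first.
    by exists (h x); rewrite comm -!gmulfM e.
  exists (h' f) => //; exists (h' x); apply: (can_inj hK).
  by rewrite !gmulfM -comm !h'K.
have e : twisted_classes psi = image^~ h @` twisted_classes phi.
  apply/seteqP; split=> [_ [g _ <-]|_ [_ [g _ <-] <-]].
    exists (twisted_class phi (h' g)); first by exists (h' g).
    by rewrite -cls h'K.
  by exists (h g) => //; apply: cls.
have c : twisted_classes psi #= twisted_classes phi.
  rewrite e; apply: inj_card_eq => C D _ _.
  have imK (B : set G) : h @^-1` (h @` B) = B.
    by apply/seteqP; split=> [x [y By /(can_inj hK) <-]|x Bx] //; exists x.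
  by move=> /(congr1 (preimage h)); rewrite !imK.
rewrite /Reidemeister_number (eq_finite_set c); case: asboolP => // -[n hn].
by rewrite (card_fset_set hn) (card_fset_set (card_eq_trans c hn)).
Qed.

Lemma Reidemeister_spectrum_iso (G H : groupType)
    (h : UMagmaMorphism.type G H) : bijective h ->
  Reidemeister_spectrum G = Reidemeister_spectrum H.
Proof.
suff sub (K L : groupType) (k : UMagmaMorphism.type K L) : bijective k ->
    Reidemeister_spectrum K `<=` Reidemeister_spectrum L.
  move=> hbij; apply/seteqP; split; first exact: sub hbij.
  have [h' hK h'K] := hbij.
  by apply: (sub _ _ (morphism_of (can2_gmulfM hK h'K))); exists h.
move=> kbij _ [phi phibij <-]; have [k' kK k'K] := kbij.
have psiM : {morph k \o phi \o k' : x y / x * y}.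
  by move=> x y /=; rewrite (can2_gmulfM kK k'K) !gmulfM.
exists (morphism_of psiM) => /=.
  by apply: bij_comp; [apply: bij_comp | exists k].
by apply: (Reidemeister_number_conj kbij) => x /=; rewrite kK.
Qed.

(** * Integer powers *)

Lemma int_step_ind (P : int -> Prop) :
  P 0%R -> (forall n, P n <-> P (n + 1)%R) -> forall n, P n.
Proof.
move=> P0 PS; elim/int_rect => // n Pn.
  by rewrite (_ : Posz n.+1 = (Posz n + 1)%R); [apply/(PS n)|lia].
by apply/(PS (- Posz n.+1)%R); rewrite (_ : (_ + 1 = - Posz n)%R) //; lia.
Qed.

Section IntegerPowers.
Variable G : groupType.
Implicit Types (x y z : G) (m n : int).

Definition zpow x n : G :=
  match n with Posz k => x ^+ k | Negz k => x ^- k.+1 end.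

Lemma zpow0 x : zpow x 0 = 1. Proof. by []. Qed.

Lemma zpowS x n : zpow x (n + 1)%R = zpow x n * x.
Proof.
case: n => [k|[|k]].
- by rewrite (_ : (Posz k + 1)%R = Posz k.+1) /= ?expgSr //; lia.
- by rewrite /= expg1 mulVg.
rewrite (_ : (Negz k.+1 + 1)%R = Negz k) /=; last by lia.
by rewrite [x ^+ k.+2]expgS invgM mulgVK.
Qed.

Lemma zpow_unique x (f : int -> G) :
  f 0%R = 1 -> (forall n, f (n + 1)%R = f n * x) -> forall n, zpow x n = f n.
Proof.
move=> f0 fS n; elim/int_step_ind: n => [|n]; first by rewrite f0.
by rewrite zpowS fS; split=> [->|/mulIg].
Qed.

Lemma zpowD x m n : zpow x (m + n)%R = zpow x m * zpow x n.
Proof.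
elim/int_step_ind: n => [|n]; first by rewrite GRing.addr0 zpow0 mulg1.
by rewrite GRing.addrA !zpowS mulgA; split=> [->|/mulIg].
Qed.

Lemma zpowM x m n : zpow x (m * n)%R = zpow (zpow x m) n.
Proof.
elim/int_step_ind: n => [|n]; first by rewrite GRing.mulr0.
by rewrite GRing.mulrDr GRing.mulr1 zpowS zpowD; split=> [->|/mulIg].
Qed.

Lemma commute_zpow x y n : commute x y -> commute x (zpow y n).
Proof.
move=> c; case: n => k /=; first exact: commuteX.
by apply: commuteV; apply: commuteX.
Qed.

(** In a group of class two, moving [x^a] past [y^b] creates one commutator for
each of the [a * b] pairs of letters. *)
Lemma zpow_commutator x y z a b :
    x * y = y * x * z -> commute x z -> commute y z ->
  zpow x a * zpow y b = zpow y b * zpow x a * zpow z (a * b)%R.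
Proof.
move=> xy xz yz.
have xa_y : zpow x a * y = y * zpow x a * zpow z a.
  elim/int_step_ind: a => [|n]; first by rewrite !zpow0 mul1g !mulg1.
  have xzn : x * zpow z n = zpow z n * x by apply: commute_zpow.
  rewrite !zpowS; move: (zpow x n) (zpow z n) xzn => u w xw.
  have -> : u * x * y = u * y * (x * z) by rewrite -mulgA xy !mulgA.
  have -> : y * (u * x) * (w * z) = y * u * w * (x * z).
    by rewrite -!mulgA (mulgA x w) xw -!mulgA.
  by split=> [->|/mulIg].
have xaz : zpow x a * zpow z a = zpow z a * zpow x a.
  by apply: commute_zpow; apply/commute_sym/commute_zpow/commute_sym.
have yza : y * zpow z a = zpow z a * y by apply: commute_zpow.
rewrite zpowM; move: (zpow x a) (zpow z a) xa_y xaz yza => u w uy uw yw.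
elim/int_step_ind: b => [|n]; first by rewrite !zpow0 mul1g !mulg1.
have ywn : y * zpow w n = zpow w n * y by apply: commute_zpow.
have wwn : w * zpow w n = zpow w n * w by apply: commute_zpow.
rewrite !zpowS; move: (zpow y n) (zpow w n) ywn wwn => v t yt wt.
have -> : v * y * u * (t * w) = v * u * t * y.
  rewrite -wt mulgA -(mulgA v) -(mulgA v) -uy !mulgA -!mulgA; congr (v * _).
  by rewrite -yt.
by rewrite mulgA; split=> [->|/mulIg].
Qed.

End IntegerPowers.

Lemma gmulf_zpow (G H : groupType) (f : UMagmaMorphism.type G H) x n :
  f (zpow x n) = zpow (f x) n.
Proof. by case: n => k /=; rewrite ?gmulfV gmulfXn. Qed.

Lemma zpow_additive (G : groupType) (chi : G -> int) :
    {morph chi : u v / u * v >-> (u + v)%R} ->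
  forall x n, chi (zpow x n) = (chi x * n)%R.
Proof.
move=> chiM x n; have chi1 : chi 1 = 0%R.
  by apply: (@GRing.addIr _ (chi 1)); rewrite -chiM mul1g GRing.add0r.
elim/int_step_ind: n => [|n]; first by rewrite GRing.mulr0.
by rewrite zpowS chiM GRing.mulrDr GRing.mulr1; split=> [->|/GRing.addIr].
Qed.

(** * The integral Heisenberg group *)

(** The triple [(a, b, c)] stands for [y^b x^a z^c] with [z = [~ x, y]]; this
order of the factors makes [a * b'] the correction term of the product. *)
Definition heis := (int * int * int)%type.
HB.instance Definition _ := Choice.on heis.

Definition heis_mul (u v : heis) : heis :=
  let: (a, b, c) := u in let: (a', b', c') := v in
  (a + a', b + b', c + c' + a * b')%R.

Definition heis_inv (u : heis) : heis :=
  let: (a, b, c) := u in (- a, - b, - c + a * b)%R.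

Definition heis_one : heis := (0, 0, 0)%R.

Lemma heis_mulA : associative heis_mul.
Proof. by move=> [[a b] c] [[a' b'] c'] [[a'' b''] c'']; congr (_, _, _); ring. Qed.

Lemma heis_mul1g : left_id heis_one heis_mul.
Proof. by move=> [[a b] c]; congr (_, _, _); ring. Qed.

Lemma heis_mulg1 : right_id heis_one heis_mul.
Proof. by move=> [[a b] c]; congr (_, _, _); ring. Qed.

Lemma heis_mulVg : left_inverse heis_one heis_inv heis_mul.
Proof. by move=> [[a b] c]; congr (_, _, _); ring. Qed.

Lemma heis_mulgV : right_inverse heis_one heis_inv heis_mul.
Proof. by move=> [[a b] c]; congr (_, _, _); ring. Qed.

HB.instance Definition _ :=
  isGroup.Build heis heis_mulA heis_mul1g heis_mulg1 heis_mulVg heis_mulgV.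

(** A triple typed as an element of the group, which makes the multiplication
of [heis] available on it. *)
Definition heis_mk (a b c : int) : heis := (a, b, c).

Lemma heis_mkM a b c a' b' c' :
  heis_mk a b c * heis_mk a' b' c' = heis_mk (a + a') (b + b') (c + c' + a * b').
Proof. by []. Qed.

Definition heis_x : heis := heis_mk 1 0 0.
Definition heis_y : heis := heis_mk 0 1 0.
Definition heis_z : heis := heis_mk 0 0 1.

Lemma heis_zC u : commute heis_z u.
Proof. by case: u => [[a b] c]; congr (_, _, _); ring. Qed.

Lemma heis_normal_form a b c :
  zpow heis_y b * zpow heis_x a * zpow heis_z c = heis_mk a b c.
Proof.
have -> : zpow heis_y b = heis_mk 0 b 0.
  exact: (@zpow_unique _ _ (fun n => heis_mk 0 n 0)).
have -> : zpow heis_x a = heis_mk a 0 0.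
  apply: (@zpow_unique _ _ (fun n => heis_mk n 0 0)) => // n.
  by cbv beta; congr (_, _, _); ring.
have -> : zpow heis_z c = heis_mk 0 0 c.
  apply: (@zpow_unique _ _ (fun n => heis_mk 0 0 n)) => // n.
  by cbv beta; congr (_, _, _); ring.
by rewrite !heis_mkM; congr (_, _, _); ring.
Qed.

(** Every commutator has the form [(0, 0, c)], hence is central. *)
Lemma heis_class2 (u v w : heis) : commute w [~ u, v].
Proof.
case: u v w => [[a b] c] [[a' b'] c'] [[a'' b''] c''].
by congr (_, _, _); ring.
Qed.

Section HeisLift.
Variables (G : groupType) (x y : G).
Hypothesis comm_x : commute x [~ x, y].
Hypothesis comm_y : commute y [~ x, y].

Definition heis_lift (u : heis) : G :=
  let: (a, b, c) := u in zpow y b * zpow x a * zpow [~ x, y] c.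

(** Reordering a product of two normal forms moves [x^a] past [y^b'], which
creates the factor [z^(a * b')] of the Heisenberg product. *)
Lemma heis_liftM : {morph heis_lift : u v / u * v}.
Proof.
have zC g n m : commute g [~ x, y] ->
    zpow [~ x, y] n * zpow g m = zpow g m * zpow [~ x, y] n.
  by move=> c; apply/commute_sym/commute_zpow/commute_sym/commute_zpow/commute_sym.
move=> [[a b] c] [[a' b'] c'] /=.
rewrite (GRing.addrC (c + c')%R) !zpowD -!mulgA; congr (_ * _).
rewrite (mulgA _ (zpow y b')) (zC y c b') // -!mulgA.
rewrite (mulgA (zpow _ c) (zpow x a')) (zC x c a') // -!mulgA.
rewrite [RHS]mulgA (zpow_commutator a b' (commgC x y)) // -!mulgA.
by rewrite (mulgA (zpow _ (a * b')%R)) (zC x (a * b')%R a') // -!mulgA.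
Qed.

Lemma heis_lift_x : heis_lift heis_x = x.
Proof. by rewrite /= expg1 mul1g mulg1. Qed.

Lemma heis_lift_y : heis_lift heis_y = y.
Proof. by rewrite /= expg1 !mulg1. Qed.

End HeisLift.

Lemma heis_hom_ext (G : groupType) (f g : UMagmaMorphism.type heis G) :
  f heis_x = g heis_x -> f heis_y = g heis_y -> f =1 g.
Proof.
move=> ex ey [[a b] c]; rewrite -[(a, b, c)]heis_normal_form !gmulfM !gmulf_zpow.
by rewrite (_ : heis_z = [~ heis_x, heis_y]) // !gmulfR ex ey.
Qed.

(** * The universal property of free groups *)

Section FreeGroupLift.
Variables (r : nat) (G : groupType) (g : 'I_r -> G).

Definition letter_lift (a : letter r) : G := if a.2 then (g a.1)^-1 else g a.1.

Definition free_lift (w : free_group r) : G :=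
  foldr (fun a h => letter_lift a * h) 1 (word_of w).

(** Cancelling a letter against its inverse does not change the value of a
word, so reduced concatenation is mapped to the product. *)
Lemma free_liftM : {morph free_lift : u v / u * v}.
Proof.
move=> [u hu] [v hv]; rewrite /free_lift /=; elim: u {hu} => [|a u IH] /=.
  by rewrite mul1g.
rewrite -mulgA -IH; case: (word_mul u v) => //= b w; case: ifP => //= /eqP ->.
rewrite mulgA (_ : letter_lift a * letter_lift (linv a) = 1) ?mul1g //.
by case: a => i [] /=; rewrite /letter_lift /= ?mulVg ?mulgV.
Qed.

End FreeGroupLift.

Definition free_gen r (i : 'I_r) : free_group r :=
  @FreeGroup r [:: (i, false)] isT.

Lemma free_lift_gen r (G : groupType) (g : 'I_r -> G) i :
  free_lift g (free_gen i) = g i.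
Proof. exact: mulg1. Qed.

Lemma free_hom_ext r (G : groupType)
    (f f' : UMagmaMorphism.type (free_group r) G) :
  (forall i, f (free_gen i) = f' (free_gen i)) -> f =1 f'.
Proof.
move=> e [w hw]; elim: w hw => [|a w IH] hw.
  by rewrite (_ : FreeGroup hw = 1) ?gmulf1 //; apply: val_inj.
have hw' : reduced w by apply: path_sorted hw.
have -> : FreeGroup hw = @FreeGroup r [:: a] isT * FreeGroup hw'.
  apply: val_inj => /=; case: w hw {IH hw'} => //= b w /andP[nb _].
  by rewrite (negbTE nb).
rewrite !gmulfM IH; congr (_ * _); case: a {hw} => i [|]; last exact: e.
rewrite (_ : FreeGroup _ = (free_gen i)^-1) ?gmulfV ?e //; exact: val_inj.
Qed.

(** * The free nilpotent group of rank and class two *)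

Section HeisIso.
Local Open Scope quotient_scope.

Local Notation F := (free_group 2).
Local Notation N := (quotient_group (lcs_nsg F 3)).

Lemma nilp_piM : {morph \pi_N : u v / u * v}.
Proof. by move=> u v; rewrite -pi_quo_mul. Qed.

Definition nilp_pi : UMagmaMorphism.type F N := morphism_of nilp_piM.

Definition gen_x : F := free_gen ord0.
Definition gen_y : F := free_gen ord_max.

Definition free_to_heis : UMagmaMorphism.type F heis :=
  morphism_of (free_liftM (fun i => if i == ord0 then heis_x else heis_y)).

(** The second term of the lower central series of the free group maps into the
central elements [(0, 0, c)], so the third one maps to the identity. *)
Lemma lcs3_free_to_heis w : lcs 3 w -> free_to_heis w = 1.
Proof.
have sub : is_subgroup [set w | free_to_heis w = 1].
  split=> [|u v eu ev]; rewrite /mkset; first exact: gmulf1.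
  by rewrite gmulfM gmulfV eu ev invg1 mulg1.
have subz : is_subgroup [set w : F | exists c, free_to_heis w = heis_mk 0 0 c].
  split=> [|u v [c ec] [d ed]]; first by exists 0%R; apply: gmulf1.
  by exists (c - d)%R; rewrite gmulfM gmulfV ec ed; congr (_, _, _); ring.
move=> w3; apply: (w3 [set w | free_to_heis w = 1]); split=> // _ [u u2 [v _ <-]].
have [c ec] : exists c, free_to_heis u = heis_mk 0 0 c.
  apply: (u2 [set w | _]); split=> // _ [s _ [t _ <-]].
  rewrite /mkset gmulfR; case: (free_to_heis s) => [[a b] c].
  case: (free_to_heis t) => [[a' b'] c'].
  by exists (a * b' - a' * b)%R; congr (_, _, _); ring.
rewrite /mkset gmulfR ec; case: (free_to_heis v) => [[a b] d].
by congr (_, _, _); ring.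
Qed.

Definition nilp_to_heis_fun (q : N) : heis := free_to_heis (repr q).

Lemma nilp_to_heis_pi w : nilp_to_heis_fun (nilp_pi w) = free_to_heis w.
Proof.
have /quo_eqP/coset_relP w3 := reprK (\pi_N w).
have := lcs3_free_to_heis w3.
by rewrite gmulfM gmulfV => /mulg1_eq; rewrite invgK.
Qed.

Lemma nilp_piP (q : N) : exists w, q = nilp_pi w.
Proof. exact: quoP. Qed.

Lemma nilp_to_heisM : {morph nilp_to_heis_fun : p q / p * q}.
Proof.
move=> p q; have [u ->] := nilp_piP p; have [v ->] := nilp_piP q.
by rewrite -gmulfM !nilp_to_heis_pi gmulfM.
Qed.

Definition nilp_to_heis : UMagmaMorphism.type N heis :=
  morphism_of nilp_to_heisM.

(** The triple commutators lie in the third term of the lower central series,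
so commutators are central in the quotient: this is what [heis_lift] needs. *)
Lemma nilp_pi_central (u v w : F) : commute (nilp_pi w) [~ nilp_pi u, nilp_pi v].
Proof.
rewrite -gmulfR; apply/commute_sym/commgP; rewrite -gmulfR.
have <- : nilp_pi 1 = 1 by apply: gmulf1.
apply/eqP/esym/quo_eqP/coset_relP; rewrite invg1 mul1g.
apply: sub_gen_smallest; exists [~ u, v]; last by exists w.
by apply: sub_gen_smallest; exists u => //; exists v.
Qed.

Definition heis_to_nilp : UMagmaMorphism.type heis N := morphism_of
  (heis_liftM (nilp_pi_central gen_x gen_y gen_x)
              (nilp_pi_central gen_x gen_y gen_y)).

(** Both composites fix the generators, hence are identities. *)
Lemma nilp_to_heis_bij : bijective nilp_to_heis.
Proof.
have tox : free_to_heis gen_x = heis_x by exact: free_lift_gen.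
have toy : free_to_heis gen_y = heis_y by exact: free_lift_gen.
have fromx : heis_to_nilp heis_x = nilp_pi gen_x by exact: heis_lift_x.
have fromy : heis_to_nilp heis_y = nilp_pi gen_y by exact: heis_lift_y.
exists heis_to_nilp => [q|u].
  have [w ->] := nilp_piP q; rewrite [nilp_to_heis _]nilp_to_heis_pi.
  apply: (@free_hom_ext _ _ (heis_to_nilp \o free_to_heis)).
  move=> i; have [->|->] : i = ord0 \/ i = ord_max.
  - by case: i => [[|[|//]] lt_i]; [left|right]; apply: val_inj.
  - exact: etrans (congr1 heis_to_nilp tox) fromx.
  - exact: etrans (congr1 heis_to_nilp toy) fromy.
apply: (@heis_hom_ext _ (nilp_to_heis \o heis_to_nilp) idfun).
  exact: etrans (congr1 nilp_to_heis fromx) (etrans (nilp_to_heis_pi _) tox).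
exact: etrans (congr1 nilp_to_heis fromy) (etrans (nilp_to_heis_pi _) toy).
Qed.

Lemma nilp_spectrum_heis :
  Reidemeister_spectrum (free_nilpotent 2 2) = Reidemeister_spectrum heis.
Proof. exact: Reidemeister_spectrum_iso nilp_to_heis_bij. Qed.

End HeisIso.

(** * Endomorphisms of the Heisenberg group *)

Section HeisEndo.
Local Open Scope ring_scope.

Lemma zpow_heis_z d n : zpow (heis_mk 0 0 d) n = heis_mk 0 0 (d * n).
Proof.
apply: (@zpow_unique _ _ (fun n => heis_mk 0 0 (d * n))) => [|m].
  by rewrite GRing.mulr0.
by cbv beta; congr (_, _, _); ring.
Qed.

Variables (psi : UMagmaMorphism.type heis heis) (p q r s i j : int).
Hypothesis psi_x : psi heis_x = heis_mk p q i.
Hypothesis psi_y : psi heis_y = heis_mk r s j.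

Let d := p * s - q * r.

(** On the centre the endomorphism is multiplication by [d], because it maps
[z = [~ x, y]] to the commutator of the images of [x] and [y].  Off the
centre the last coordinate also picks up [t a b], a polynomial of degree at
most two in [a] and [b]. *)
Lemma heis_endoE : exists t : int -> int -> int, t 0 0 = 0 /\
  forall a b c, psi (heis_mk a b c) =
    heis_mk (p * a + r * b) (q * a + s * b) (t a b + d * c).
Proof.
have psi_z c : psi (heis_mk 0 0 c) = heis_mk 0 0 (d * c).
  have -> : heis_mk 0 0 c = zpow [~ heis_x, heis_y]%g c.
    by rewrite (zpow_heis_z 1 c) GRing.mul1r.
  rewrite gmulf_zpow gmulfR psi_x psi_y -zpow_heis_z; congr (zpow _ c).
  by congr (_, _, _); rewrite /d; ring.
exists (fun a b => (psi (heis_mk a b 0)).2); split.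
  by rewrite psi_z /= GRing.mulr0.
move=> a b c.
have -> : heis_mk a b c = (heis_mk a b 0 * heis_mk 0 0 c)%g.
  by congr (_, _, _); ring.
rewrite gmulfM psi_z.
have fE : (psi (heis_mk a b 0)).1 = (p * a + r * b, q * a + s * b).
  rewrite -(heis_normal_form a b 0) zpow0 mulg1 gmulfM !gmulf_zpow psi_x psi_y.
  have fstM : {morph (fun u : heis => u.1.1) : u v / (u * v)%g >-> u + v}.
    by move=> [[? ?] ?] [[? ?] ?].
  have sndM : {morph (fun u : heis => u.1.2) : u v / (u * v)%g >-> u + v}.
    by move=> [[? ?] ?] [[? ?] ?].
  have := zpow_additive fstM (heis_mk p q i) a.
  have := zpow_additive sndM (heis_mk p q i) a.
  have := zpow_additive fstM (heis_mk r s j) b.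
  have := zpow_additive sndM (heis_mk r s j) b.
  case: (zpow _ b) (zpow _ a) => [[? ?] ?] [[? ?] ?] /= -> -> -> ->.
  by congr (_, _); ring.
rewrite [in LHS](surjective_pairing (psi (heis_mk a b 0))) fE.
by congr (_, _, _); ring.
Qed.

End HeisEndo.

(** * Twisted conjugacy in the Heisenberg group *)

Section HeisTwisted.
Local Open Scope ring_scope.

Variables (psi : UMagmaMorphism.type heis heis) (p q r s i j : int).
Hypothesis psi_x : psi heis_x = heis_mk p q i.
Hypothesis psi_y : psi heis_y = heis_mk r s j.

Let d := p * s - q * r.
(** The determinant of [1 - M]. *)
Let e := (1 - p) * (1 - s) - q * r.

Lemma heis_twistedE : exists t : int -> int -> int, t 0 0 = 0 /\
  forall g1 g2 g3 f1 f2 f3,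
    twisted_conj psi (heis_mk g1 g2 g3) (heis_mk f1 f2 f3) <->
    exists a b c, [/\ p * a + r * b + g1 = f1 + a, q * a + s * b + g2 = f2 + b
      & t a b + d * c + g3 + (p * a + r * b) * g2 = f3 + c + f1 * b].
Proof.
have [t [t0 psiE]] := heis_endoE psi_x psi_y; exists t; split=> //.
move=> g1 g2 g3 f1 f2 f3; split=> [[[[a b] c]]|[a [b [c [e1 e2 e3]]]]].
  by rewrite [psi _](psiE a b c) => -[e1 e2 e3]; exists a, b, c.
by exists (heis_mk a b c); rewrite psiE; congr (_, _, _).
Qed.

(** The columns of the inverse matrix come from preimages of [x] and [y]. *)
Lemma heis_det : bijective psi -> d = 1 \/ d = -1.
Proof.
case=> psi' _ psiK; have [t [_ psiE]] := heis_endoE psi_x psi_y.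
have := psiK heis_x; case: (psi' heis_x) => [[a b] c].
rewrite [psi _](psiE a b c) => -[e1 e2 _].
have := psiK heis_y; case: (psi' heis_y) => [[a' b'] c'].
rewrite [psi _](psiE a' b' c') => -[e3 e4 _].
have : d * (a * b' - a' * b) = 1.
  have -> : d * (a * b' - a' * b) =
    (p * a + r * b) * (q * a' + s * b') - (p * a' + r * b') * (q * a + s * b).
    by rewrite /d; ring.
  by rewrite e1 e2 e3 e4.
move=> /(congr1 absz); rewrite abszM => /eqP; rewrite muln_eq1 => /andP[/eqP + _].
by move: d => D; lia.
Qed.

(** Cramer's rule. *)
Lemma no_fixed_vector a b : e != 0 ->
  p * a + r * b = a -> q * a + s * b = b -> a = 0 /\ b = 0.
Proof.
move=> e0 ea eb.
have : e * a = 0.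
  have -> : e * a = (1 - s) * (a - (p * a + r * b)) + r * (b - (q * a + s * b)).
    by rewrite /e; ring.
  by rewrite ea eb; ring.
have : e * b = 0.
  have -> : e * b = q * (a - (p * a + r * b)) + (1 - p) * (b - (q * a + s * b)).
    by rewrite /e; ring.
  by rewrite ea eb; ring.
by nia.
Qed.

(** A left eigenvector of the matrix for the eigenvalue [1]: a nonzero row of
the adjugate of [1 - M] is one, and if the adjugate vanishes, then [M = 1]. *)
Lemma invariant_functional : e = 0 ->
  exists u v : int, [/\ u * p + v * q = u, u * r + v * s = v & (u, v) <> (0, 0)].
Proof.
rewrite /e => e0; have [q0|q0] := eqVneq q 0.
  have [p1|p1] := eqVneq p 1; last first.
    by exists q, (1 - p); split; [ring|lia|move=> [qq pp]; lia].
  have [|ne] := pselect ((1 - s, r) = (0, 0)).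
    by case=> s1 r0; exists 1, 0; split; [rewrite p1; ring|rewrite r0; ring|].
  by exists (1 - s), r; split=> //; [rewrite p1 q0; ring|ring].
by exists q, (1 - p); split; [ring|lia|move=> [qq pp]; lia].
Qed.

(** The linear form [u * g1 + v * g2] is constant on twisted classes and takes
infinitely many values. *)
Lemma Reidemeister_heis_eigen1 : e = 0 -> Reidemeister_number psi = None.
Proof.
move=> e0; have [u [v [eu ev uv0]]] := invariant_functional e0.
have [t [_ tcE]] := heis_twistedE.
have key a b m n m' n' : p * a + r * b + m = n + a ->
    q * a + s * b + m' = n' + b -> u * (m - n) + v * (m' - n') = 0.
  move=> e1 e2.
  have -> : u * (m - n) + v * (m' - n') =
    u * (p * a + r * b + m - (n + a)) + v * (q * a + s * b + m' - (n' + b))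
    - a * (u * p + v * q - u) - b * (u * r + v * s - v) by ring.
  by rewrite e1 e2 eu ev; ring.
have [u0|u0] := eqVneq u 0.
  have v0 : v <> 0 by move=> v0; apply: uv0; rewrite u0 v0.
  apply: (@Reidemeister_number_infinite _ _ (fun n => heis_mk 0 (Posz n) 0)).
  move=> m n /tcE[a [b [c [e1 e2 _]]]]; have := key _ _ _ _ _ _ e1 e2; nia.
apply: (@Reidemeister_number_infinite _ _ (fun n => heis_mk (Posz n) 0 0)).
move=> m n /tcE[a [b [c [e1 e2 _]]]]; have := key _ _ _ _ _ _ e1 e2; nia.
Qed.

(** An [x] that twists one central element to another is central, hence fixed
by [psi], so the two elements are equal. *)
Lemma Reidemeister_heis_det1 : d = 1 -> Reidemeister_number psi = None.
Proof.
have [e0|e0] := eqVneq e 0; first by rewrite Reidemeister_heis_eigen1.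
move=> d1; have [t [t0 tcE]] := heis_twistedE.
apply: (@Reidemeister_number_infinite _ _ (fun n => heis_mk 0 0 (Posz n))).
move=> m n /tcE[a [b [c [e1 e2]]]].
have [-> ->] : a = 0 /\ b = 0 by apply: no_fixed_vector; lia.
by rewrite t0 d1; lia.
Qed.

(** If [z * g] and [g] are twisted conjugate by [x], then [x] is central, say
[x = z^c], and comparing exponents of [z] gives [1 = 2 * c]. *)
Lemma Reidemeister_heis_detN1 : d = -1 -> Reidemeister_number psi <> None ->
  exists2 k, (0 < k)%N & Reidemeister_number psi = Some (2 * k)%N.
Proof.
move=> d1 fin; have e0 : e != 0.
  by apply/eqP => /Reidemeister_heis_eigen1.
have [t [t0 tcE]] := heis_twistedE.
apply: (@Reidemeister_number_even _ _ heis_z) => // [g||[[g1 g2] g3] /tcE].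
- exact: heis_zC.
- have [t' [t'0 psiE]] := heis_endoE psi_x psi_y.
  by rewrite psiE t'0 -/d d1; congr (_, _, _); ring.
case=> a [b [c [e1 e2]]].
have [-> ->] : a = 0 /\ b = 0 by apply: no_fixed_vector; lia.
by rewrite t0 d1; lia.
Qed.

End HeisTwisted.

(** * Realization of every even number *)

Section Realization.
Local Open Scope ring_scope.
Variable k : nat.
Hypothesis k_gt0 : (0 < k)%N.

Let X := heis_mk k 1 0.
Let Y := heis_mk 1 0 0.

(** The map [x |-> y * x^k], [y |-> x]; its matrix is the companion matrix of
[T^2 - k T - 1]. *)
Definition companion_endo : UMagmaMorphism.type heis heis :=
  morphism_of (heis_liftM (heis_class2 X Y X) (heis_class2 X Y Y)).

Let psi_x : companion_endo heis_x = heis_mk k 1 0.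
Proof. exact: heis_lift_x. Qed.

Let psi_y : companion_endo heis_y = heis_mk 1 0 0.
Proof. exact: heis_lift_y. Qed.

Lemma companion_endo_bij : bijective companion_endo.
Proof.
have [t [_ psiE]] := heis_endoE psi_x psi_y.
exists (fun u : heis => let: (a, b, c) := u in
  heis_mk b (a - k%:Z * b) (t b (a - k%:Z * b) - c)) => -[[a b] c].
  rewrite [companion_endo _](psiE a b c) /heis_mk /=.
  have -> : 1 * a + 0 * b = a by ring.
  have -> : k%:Z * a + 1 * b - k%:Z * a = b by ring.
  by congr (_, _, _); ring.
by rewrite psiE; congr (_, _, _); ring.
Qed.

(** Abelianizing, [g] and [f] are conjugate by [(a, b)] exactly when
[(f1 + f2) - (g1 + g2) = k * a] and [b = a - (f2 - g2)].  This leaves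
[g1 + g2] modulo [k] as an invariant and determines [a] and [b]; the central
exponent [c] of the conjugating element then shifts the last coordinate by
[2 * c], which leaves a parity. *)
Lemma Reidemeister_companion_endo :
  Reidemeister_number companion_endo = Some (2 * k)%N.
Proof.
have [t [t0 tcE]] := heis_twistedE psi_x psi_y.
have -> : (2 * k)%N = #|{: 'I_k * bool}|.
  by rewrite card_prod card_ord card_bool mulnC.
apply: (@Reidemeister_number_representatives _ _ _
  (fun v : 'I_k * bool => heis_mk (Posz v.1) 0 (Posz v.2))).
  move=> [[m lt_m] b1] [[n lt_n] b2] /= /tcE[a [b [c [e1 e2 e3]]]].
  have b0 : b = a by lia.
  have a0 : a = 0 by nia.
  move: e1 e3; rewrite b0 a0 t0 => e1 e3.
  have emn : m = n by lia.
  subst n; congr (_, _); first exact: val_inj.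
  by case: b1 b2 e3 => [] []; lia.
move=> [[f1 f2] f3].
pose a := ((f1 + f2) %/ k)%Z; pose m := `|((f1 + f2) %% k)%Z|%N.
have div_k : f1 + f2 = a * k + m by rewrite /a /m; lia.
have lt_m : (m < k)%N by rewrite /m; lia.
(* N is the last coordinate still to be matched once a and b are known *)
pose N := f3 + f1 * (a - f2) - t a (a - f2).
pose odd_N := (N %% 2)%Z == 1; pose c := (N %/ 2)%Z.
have div_2 : N = c * 2 + Posz odd_N by rewrite /c /odd_N; lia.
exists (Ordinal lt_m, odd_N) => /=; apply/tcE; exists a, (a - f2), (- c).
by split; [lia|lia|rewrite /N in div_2; lia].
Qed.

End Realization.

Lemma heis_spectrum : Reidemeister_spectrum heis =
  [set Some (2 * k)%N | k in [set k : nat | (0 < k)%N]] `|` [set None].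
Proof.
apply/seteqP; split=> [_ [psi bij_psi <-]|_ [[k k_gt0 <-]|->]].
- have [[[p q] i] psi_x] : exists u : heis, psi heis_x = u by eexists.
  have [[[r s] j] psi_y] : exists u : heis, psi heis_y = u by eexists.
  have [d1|dN1] := heis_det psi_x psi_y bij_psi.
    by right; exact: Reidemeister_heis_det1 psi_x psi_y d1.
  have [->|fin] := pselect (Reidemeister_number psi = None); first by right.
  have [k k_gt0 ->] := Reidemeister_heis_detN1 psi_x psi_y dN1 fin.
  by left; exists k.
- exists (companion_endo k); first exact: companion_endo_bij.
  exact: Reidemeister_companion_endo.
- exists idfun; first by exists idfun.
  exact: (@Reidemeister_heis_det1 idfun 1 0 0 1 0 0).
Qed.

Theorem mainTheorem1 :
  Reidemeister_spectrum (free_nilpotent 2 2) =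
    [set Some (2 * k)%N | k in [set k : nat | (0 < k)%N]] `|` [set None].
Proof. by rewrite nilp_spectrum_heis heis_spectrum. Qed.
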